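(* The collection $\mathfrak{R}_\alpha$ satisfies Coarse Permanence for every ordinal $\alpha$. In particular: (1) A subfamily of a metric family in $\mathfrak{R}_\alpha$ also lies in $\mathfrak{R}_\alpha$. (2) If $\mathcal{X}$ and $\mathcal{Y}$ are coarsely equivalent metric families, then $\mathcal{X}\in\mathfrak{R}_\alpha$ if and only if $\mathcal{Y}\in\mathfrak{R}_\alpha$.
   Context: A metric family is a set of metric spaces. A map of metric families $F\colon\mathcal{X}\to\mathcal{Y}$ is a collection of functions $f\colon X\to Y$ with $X\in\mathcal{X}$, $Y\in\mathcal{Y}$, such that each element of $\mathcal{X}$ is the domain of at least one function in $F$. The composition $G\circ F$ is $\{g\circ f\mid f\in F, g\in G,\ \text{the domain of } g \text{ is the range (codomain) of } f\}$. $F$ is coarse if there is a non-decreasing function $\rho\colon[0,\infty)\to[0,\infty)$ with $d_Y(f(x),f(y))\le\rho(d_X(x,y))$ for all $f\colon X\to Y$ in $F$ and $x,y\in X$. $F$ is effectively proper if there is a proper non-decreasing $\delta\colon[0,\infty)\to[0,\infty)$ with $\delta(d_X(x,y))\le d_Y(f(x),f(y))$ for all such $f,x,y$. $F$ is a coarse embedding if it is coarse and effectively proper. $F$ is close to $F'\colon\mathcal{X}\to\mathcal{Y}$ if there is $C\ge0$ such that for every $f\colon X\to Y$ in $F$ (respectively, in $F'$) there is $h\colon X\to Y$ in $F'$ (respectively, in $F$) with $d_Y(f(x),h(x))\le C$ for all $x\in X$. $F$ is a coarse equivalence if it is coarse and there is a coarse map $G\colon\mathcal{Y}\to\mathcal{X}$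 such that $G\circ F$ and $F\circ G$ are close to the identity maps of $\mathcal{X}$ and $\mathcal{Y}$; then $\mathcal{X}$ and $\mathcal{Y}$ are coarsely equivalent. A subfamily of $\mathcal{Y}$ is a metric family each of whose members is a subspace of some $Y\in\mathcal{Y}$; the inverse image of a subfamily $\mathcal{B}$ is $F^{-1}(\mathcal{B})=\{f^{-1}(B)\mid B\in\mathcal{B},\ f\in F\}$ (where $B$ is a subspace of the codomain of $f$). $\mathcal{X}$ is bounded if $\sup_{X\in\mathcal{X}}\operatorname{diam}X<\infty$. $\operatorname{asdim}(\mathcal{X})\le n$ means: for every $r>0$, each $X\in\mathcal{X}$ has a decomposition $X=X_0\cup\dots\cup X_n$ where each $X_i$ is a union of subspaces $X_{ij}$, $j\in J_i$, with $d(x,y)>r$ whenever $x\in X_{ij}$, $y\in X_{ij'}$, $j\ne j'$, such that the family of all $X_{ij}$ (over all $X$, $i$, $j$) is bounded. $\mathcal{X}$ has finite asymptotic dimension if $\operatorname{asdim}(\mathcal{X})\le n$ for some $n$. Let $\mathfrak{R}_0$ be the collection of bounded metric families. For an ordinal $\alpha>0$, $\mathcal{X}\in\mathfrak{R}_\alpha$ if there are a metric family $\mathcal{Y}$ with finite asymptotic dimension and a coarse map $F\colon\mathcal{X}\to\mathcal{Y}$ such that for every bounded subfamily $\mathcal{B}$ of $\mathcal{Y}$ there is an ordinal $\beta<\alpha$ with $F^{-1}(\mathcal{B})\in\mathfrak{R}_\beta$. A collection $\mathfrak{C}$ of metric families satisfies Coarse Permanence if whenever $\mathcal{Y}\in\mathfrak{C}$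 and $F\colon\mathcal{X}\to\mathcal{Y}$ is a coarse embedding, then $\mathcal{X}\in\mathfrak{C}$. *)

(* Defs.v *)
From HB Require Import structures.
From mathcomp Require Import all_boot all_order all_algebra.
From mathcomp Require Import all_classical all_reals all_analysis.

Set Implicit Arguments.
Unset Strict Implicit.
Unset Printing Implicit Defensive.

Import Order.TTheory GRing.Theory Num.Theory.
Import numFieldNormedType.Exports.

Local Open Scope classical_set_scope.
Local Open Scope ring_scope.

(* The library already gives [set_type A] the pseudometric induced from [X]. *)
Section subspace_metric.
Context {R : realType} {X : metricType R} (A : set X).

Let dist (x y : set_type A) : R := mdist (set_val x) (set_val y).

Let dist_ge0 x y : 0 <= dist x y.
Proof. exact: mdist_ge0. Qed.

Let dist_positivity x y : dist x y = 0 -> x = y.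
Proof. by move=> /mdist_positivity /val_inj. Qed.

Let ballE (x : set_type A) (e : R) : ball x e = [set y | dist x y < e].
Proof.
rewrite /ball /= /initial_ball; apply/seteqP.
by split => y; rewrite /= ballEmdist.
Qed.

HB.instance Definition _ := @PseudoMetric_isMetric.Build R (set_type A)
  dist dist_ge0 dist_positivity ballE.

End subspace_metric.

Section metric_families.
Context {R : realType}.

(* [set (metricType R)] is rejected as a universe inconsistency, so families are
   written as plain predicates. *)
Definition metric_family := metricType R -> Prop.

(* [-oo] for the empty space, which does not affect the boundedness of a
   family. *)
Definition diam (X : metricType R) : \bar R :=
  ereal_sup [set (mdist p.1 p.2)%:E | p in [set: X * X]].

Definition bounded_family (XX : metric_family) : Prop :=
  (ereal_sup [set t | exists X, XX X /\ diam X = t] < +oo)%E.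

Record family_map (XX YY : metric_family) := FamilyMap {
  fm_mem :> forall X Y : metricType R, set (X -> Y);
  fm_sub : forall (X Y : metricType R) (f : X -> Y),
    fm_mem f -> XX X /\ YY Y;
  fm_total : forall X : metricType R,
    XX X -> exists (Y : metricType R) (f : X -> Y), fm_mem f
}.

Inductive id_mem (XX : metric_family) :
    forall X Y : metricType R, (X -> Y) -> Prop :=
  IdMem (X : metricType R) of XX X : id_mem XX (@id X).

Lemma id_mem_sub XX (X Y : metricType R) (f : X -> Y) :
  id_mem XX f -> XX X /\ XX Y.
Proof. by case. Qed.

Lemma id_mem_total XX (X : metricType R) :
  XX X -> exists (Y : metricType R) (f : X -> Y), id_mem XX f.
Proof. by move=> XXX; exists X, id; constructor. Qed.

Definition family_id XX : family_map XX XX :=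
  FamilyMap (@id_mem_sub XX) (@id_mem_total XX).

Section composition.
Variables (XX YY ZZ : metric_family).
Variables (G : family_map YY ZZ) (F : family_map XX YY).

Definition comp_mem (X Z : metricType R) : set (X -> Z) :=
  [set h | exists (Y : metricType R) (f : X -> Y) (g : Y -> Z),
    [/\ F X Y f, G Y Z g & h = g \o f]].

Lemma comp_mem_sub (X Z : metricType R) (h : X -> Z) :
  comp_mem h -> XX X /\ ZZ Z.
Proof.
move=> [Y [f [g [Ff Gg _]]]].
by split; [case: (fm_sub Ff)|case: (fm_sub Gg)].
Qed.

Lemma comp_mem_total (X : metricType R) :
  XX X -> exists (Z : metricType R) (h : X -> Z), comp_mem h.
Proof.
move=> XXX; have [Y [f Ff]] := fm_total F XXX.
have [_ YYY] := fm_sub Ff; have [Z [g Gg]] := fm_total G YYY.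
by exists Z, (g \o f), Y, f, g.
Qed.

Definition family_comp : family_map XX ZZ :=
  FamilyMap comp_mem_sub comp_mem_total.

End composition.

(* [rho : R -> R] represents a non-decreasing function from [0, +oo[ to itself;
   its values at negative reals are irrelevant. *)
Definition control_fun (rho : R -> R) : Prop :=
  (forall t, 0 <= t -> 0 <= rho t) /\
  (forall s t, 0 <= s -> s <= t -> rho s <= rho t).

(* Properness as a function on [0, +oo[, without any continuity. *)
Definition proper_fun (delta : R -> R) : Prop :=
  forall B : set R, bounded_set B ->
    bounded_set ([set t | 0 <= t] `&` delta @^-1` B).

Section properties_of_maps.
Variables (XX YY : metric_family).
Implicit Types F : family_map XX YY.

Definition coarse F : Prop :=
  exists rho : R -> R, control_fun rho /\
    forall (X Y : metricType R) (f : X -> Y), F X Y f ->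
      forall x y, mdist (f x) (f y) <= rho (mdist x y).

Definition effectively_proper F : Prop :=
  exists delta : R -> R, [/\ control_fun delta, proper_fun delta &
    forall (X Y : metricType R) (f : X -> Y), F X Y f ->
      forall x y, delta (mdist x y) <= mdist (f x) (f y)].

Definition coarse_embedding F : Prop := coarse F /\ effectively_proper F.

Definition close F F' : Prop :=
  exists C : R, [/\ 0 <= C,
    forall (X Y : metricType R) (f : X -> Y), F X Y f ->
      exists2 h : X -> Y, F' X Y h & forall x, mdist (f x) (h x) <= C &
    forall (X Y : metricType R) (f : X -> Y), F' X Y f ->
      exists2 h : X -> Y, F X Y h & forall x, mdist (f x) (h x) <= C].

End properties_of_maps.

Definition coarse_equivalence (XX YY : metric_family) (F : family_map XX YY) :
    Prop :=
  coarse F /\ exists G : family_map YY XX,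
    [/\ coarse G, close (family_comp G F) (family_id XX) &
        close (family_comp F G) (family_id YY)].

Definition coarsely_equivalent (XX YY : metric_family) : Prop :=
  exists F : family_map XX YY, coarse_equivalence F.

(* Each member is recorded with the space of [YY] of which it is a subspace. *)
Record subfamily (YY : metric_family) := Subfamily {
  sf_mem :> forall Y : metricType R, set (set Y);
  sf_sub : forall (Y : metricType R) (B : set Y), sf_mem B -> YY Y
}.

Definition members (YY : metric_family) (BB : subfamily YY) : metric_family :=
  fun Z => exists (Y : metricType R) (B : set Y),
    BB Y B /\ Z = set_type B :> metricType R.

Section inverse_image.
Variables (XX YY : metric_family) (F : family_map XX YY) (BB : subfamily YY).

Definition inverse_image_mem (X : metricType R) : set (set X) :=
  [set A | exists (Y : metricType R) (f : X -> Y) (B : set Y),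
    [/\ F X Y f, BB Y B & A = f @^-1` B]].

Lemma inverse_image_sub (X : metricType R) (A : set X) :
  inverse_image_mem A -> XX X.
Proof. by move=> [Y [f [B [Ff _ _]]]]; case: (fm_sub Ff). Qed.

Definition inverse_image : subfamily XX := Subfamily inverse_image_sub.

End inverse_image.

Definition asdim_le (XX : metric_family) (n : nat) : Prop :=
  forall r : R, 0 < r ->
  exists (J : metricType R -> 'I_n.+1 -> Type)
         (P : forall (X : metricType R) (i : 'I_n.+1), J X i -> set X),
  [/\ forall X : metricType R, XX X ->
        [set: X] = \bigcup_(i in [set: 'I_n.+1]) \bigcup_(j in [set: J X i])
          P X i j,
      forall X : metricType R, XX X ->
        forall (i : 'I_n.+1) (j j' : J X i), j <> j' ->
        forall x y : X, P X i j x -> P X i j' y -> r < mdist x y &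
      bounded_family (fun Z => exists (X : metricType R) (i : 'I_n.+1)
        (j : J X i), XX X /\ Z = set_type (P X i j) :> metricType R)].

Definition finite_asdim (XX : metric_family) : Prop :=
  exists n, asdim_le XX n.

(* Ordinals are represented by the elements of a well-ordered type [W]: [a : W]
   stands for the order type of its initial segment [[set b | b < a]], and the
   ordinals below it are represented by the [b < a].  The ordinal 0 is the least
   element of [W].  Every ordinal arises so, from a suitable [W]. *)
Inductive frakR {d} {W : orderType d} : W -> metric_family -> Prop :=
| frakR_zero (a : W) XX :
    (forall b : W, (a <= b)%O) -> bounded_family XX -> frakR a XX
| frakR_pos (a : W) XX YY (F : family_map XX YY) :
    (exists b : W, (b < a)%O) ->
    finite_asdim YY -> coarse F ->
    (forall BB : subfamily YY, bounded_family (members BB) ->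
      exists2 b : W, (b < a)%O & frakR b (members (inverse_image F BB))) ->
    frakR a XX.

Definition coarse_permanence (CC : metric_family -> Prop) : Prop :=
  forall (XX YY : metric_family) (F : family_map XX YY),
    CC YY -> coarse_embedding F -> CC XX.

End metric_families.

Arguments metric_family : clear implicits.

(* Main.v *)
Require Import Defs.
From mathcomp Require Import all_boot all_order all_algebra.
From mathcomp Require Import all_classical wochoice all_reals all_analysis.
From mathcomp Require Import lra.

(** Coarse permanence is proved by well-founded induction on the ordinal [a].
    Let [F : XX -> YY] be a coarse embedding with [YY] in [frakR a].  If [a] is
    zero, [YY] is bounded, and effective properness bounds [XX]
    ([bounded_family_effectively_proper]).  If [a] is positive, membership of
    [YY] is witnessed by a coarse map [G : YY -> ZZ] into a family of finite
    asymptotic dimension, and the composite of [G] and [F] witnesses membership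
    of [XX].  Indeed, the inverse image of a bounded subfamily [BB] under the
    composite is [F^-1 (G^-1 BB)] ([members_inverse_image_comp]); here [G^-1 BB]
    lies in some [frakR b] with [b < a], and [F] restricts to a coarse embedding
    of [F^-1 (G^-1 BB)] into [G^-1 BB] ([restriction_coarse_embedding]), so the
    induction hypothesis applies.

    The two other assertions produce coarse embeddings: the inclusion of a
    subfamily is isometric, and a coarse equivalence is effectively proper since
    a coarse inverse bounds [mdist x y] in terms of [mdist (f x) (f y)]. *)

Set Implicit Arguments.
Unset Strict Implicit.
Unset Printing Implicit Defensive.

Import Order.TTheory GRing.Theory Num.Theory.
Import numFieldNormedType.Exports.

Local Open Scope classical_set_scope.
Local Open Scope ring_scope.

Section coarse_permanence.
Context {R : realType}.
Implicit Types (XX YY ZZ : metric_family R).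

(** * Bounded families and effectively proper maps *)

Lemma bounded_familyP XX : bounded_family XX <->
  exists M : R, forall X : metricType R, XX X -> forall x y : X, mdist x y <= M.
Proof.
split=> [bXX|[M XXM]]; last first.
  rewrite /bounded_family (@le_lt_trans _ _ M%:E) ?ltry//.
  apply: ge_ereal_sup => _ [X [XXX <-]].
  by apply: ge_ereal_sup => _ [[x y] _ <-]; rewrite lee_fin XXM.
exists (fine (ereal_sup [set t | exists X, XX X /\ diam X = t])) => X XXX x y.
have le_sup : ((mdist x y)%:E <=
    ereal_sup [set t | exists X, XX X /\ diam X = t])%E.
  apply: (@le_trans _ _ (diam X)).
    by apply: ereal_sup_ubound; exists (x, y).
  by apply: ereal_sup_ubound; exists X.
by rewrite -lee_fin fineK// fin_real// bXX (lt_le_trans (ltNyr _) le_sup).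
Qed.

Lemma bounded_family_effectively_proper XX YY (F : family_map XX YY) :
  effectively_proper F -> bounded_family YY -> bounded_family XX.
Proof.
move=> [delta [[delta_ge0 _] delta_proper Fdelta]] /bounded_familyP[M YYM].
apply/bounded_familyP.
have : bounded_set [set t : R | `|t| <= M].
  by exists M; split=> [|x Mx t /le_trans]; [exact: num_real|apply; exact: ltW].
move=> /delta_proper[N [_ /(_ (N + 1))]].
rewrite ltrDl ltr01 => /(_ isT) deltaN; exists (N + 1) => X XXX x y.
have [Y [f Ff]] := fm_total F XXX; have [_ YYY] := fm_sub Ff.
rewrite -[leLHS]ger0_norm ?mdist_ge0//; apply: deltaN.
split; first exact: mdist_ge0.
rewrite /= ger0_norm ?delta_ge0 ?mdist_ge0//.
exact: le_trans (Fdelta _ _ _ Ff _ _) (YYM _ YYY _ _).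
Qed.

(** The lower control function is the generalized inverse of
    [fun s => sigma s + s].  The summand [s] makes this function unbounded even
    if [sigma] is bounded, so that the infimum is over a nonempty set. *)
Lemma effectively_proper_of_upper_bound XX YY (F : family_map XX YY)
    (sigma : R -> R) : control_fun sigma ->
  (forall (X Y : metricType R) (f : X -> Y), F X Y f ->
    forall x y, mdist x y <= sigma (mdist (f x) (f y))) ->
  effectively_proper F.
Proof.
move=> [sigma_ge0 sigma_nd] Fsigma.
pose E t := [set s : R | 0 <= s /\ t <= sigma s + s].
have E_lb t : has_lbound (E t) by exists 0 => s [].
have E_mem t : E t (Num.max 0 t).
  have s0 : 0 <= Num.max 0 t by rewrite le_max lexx.
  by split=> //; rewrite ler_wpDl ?sigma_ge0// le_max lexx orbT.
have E_neq0 t : E t !=set0 by exists (Num.max 0 t).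
exists (fun t => inf (E t)); split.
- split=> [t _|s t _ st]; apply: lb_le_inf => // u [u0 tu] //.
  by apply: ge_inf => //; split=> //; exact: le_trans tu.
- move=> B [M [_ /(_ (Num.max 0 M + 1))]].
  rewrite (@le_lt_trans _ _ (Num.max 0 M)) ?le_max ?lexx ?orbT//; last first.
    by rewrite ltrDl.
  move=> /(_ isT); set m := Num.max 0 M + 1 => Bm.
  have m0 : 0 <= m by rewrite addr_ge0// le_max lexx.
  exists (sigma (m + 1) + (m + 1)); split=> [|x Mx t [/= t0 Bt]].
    exact: num_real.
  rewrite ger0_norm//; apply: le_trans (ltW Mx).
  have [s [s0 ts] sE] := inf_adherent ltr01 (conj (E_neq0 t) (E_lb t)).
  have sm : s <= m + 1.
    by rewrite (le_trans (ltW sE))// lerD2r (le_trans (ler_norm _))// Bm.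
  by rewrite (le_trans ts)// lerD// sigma_nd.
- move=> X Y f Ff x y; apply: ge_inf => //; split; first exact: mdist_ge0.
  by rewrite (le_trans (Fsigma _ _ _ Ff _ _))// lerDl mdist_ge0.
Qed.

(** * Composition, restriction and inclusion *)

Lemma coarse_comp XX YY ZZ (G : family_map YY ZZ) (F : family_map XX YY) :
  coarse G -> coarse F -> coarse (family_comp G F).
Proof.
move=> [rhoG [[rhoG_ge0 rhoG_nd] Grho]] [rhoF [[rhoF_ge0 rhoF_nd] Frho]].
exists (rhoG \o rhoF); split.
  split=> [t t0|s t s0 st] /=; first by rewrite rhoG_ge0 ?rhoF_ge0.
  by rewrite rhoG_nd ?rhoF_ge0 ?rhoF_nd.
move=> X Z h [Y [f [g [Ff Gg ->]]]] x y /=.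
by rewrite (le_trans (Grho _ _ _ Gg _ _))// rhoG_nd ?mdist_ge0 ?Frho.
Qed.

Lemma members_inverse_image_comp XX YY ZZ (G : family_map YY ZZ)
    (F : family_map XX YY) (BB : subfamily ZZ) :
  members (inverse_image (family_comp G F) BB) =
  members (inverse_image F (inverse_image G BB)).
Proof.
apply/funext => T; apply/propext; split.
  move=> [X [A [[Z [h [B [[Y [f [g [Ff Gg ->]]]] BBB ->]]]] ->]]].
  exists X, (f @^-1` (g @^-1` B)); split=> //.
  by exists Y, f, (g @^-1` B); split=> //; exists Z, g, B.
move=> [X [A [[Y [f [C [Ff [Z [g [B [Gg BBB ->]]]] ->]]]] ->]]].
exists X, ((g \o f) @^-1` B); split=> //.
by exists Z, (g \o f), B; split=> //; exists Y, f, g.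
Qed.

Section restriction.
Variables (XX YY : metric_family R) (F : family_map XX YY) (BB : subfamily YY).

(** An inductive family over the domain and the codomain spares transporting
    functions along equalities of metric spaces. *)
Inductive restriction_mem : forall X Y : metricType R, (X -> Y) -> Prop :=
  RestrictionMem (X Y : metricType R) (f : X -> Y) (B : set Y)
    (h : set_type (f @^-1` B) -> set_type B) of
    F X Y f & BB Y B & (forall x, set_val (h x) = f (set_val x)) :
  restriction_mem h.

Lemma restriction_mem_sub (X Y : metricType R) (h : X -> Y) :
  restriction_mem h ->
  members (inverse_image F BB) X /\ members BB Y.
Proof.
case=> {X Y h} X Y f B h Ff BBB _; split; last by exists Y, B.
by exists X, (f @^-1` B); split=> //; exists Y, f, B.
Qed.

Lemma restriction_mem_total (X : metricType R) :
  members (inverse_image F BB) X ->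
  exists (Y : metricType R) (h : X -> Y), restriction_mem h.
Proof.
move=> [{}X [A [[Y [f [B [Ff BBB ->]]]] ->]]].
pose h (x : set_type (f @^-1` B)) : set_type B :=
  exist _ (f (set_val x)) (mem_set (set_valP x)).
by exists (set_type B : metricType R), h; apply: RestrictionMem.
Qed.

Definition restriction : family_map (members (inverse_image F BB)) (members BB) :=
  FamilyMap restriction_mem_sub restriction_mem_total.

Lemma restriction_coarse_embedding :
  coarse_embedding F -> coarse_embedding restriction.
Proof.
move=> [[rho [rhoc Frho]] [delta [deltac deltap Fdelta]]]; split.
  exists rho; split=> // _ _ _ [X Y f B h Ff BBB hE] x y.
  by rewrite /mdist/= !hE; exact: Frho.
exists delta; split=> // _ _ _ [X Y f B h Ff BBB hE] x y.
by rewrite /mdist/= !hE; exact: Fdelta.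
Qed.

End restriction.

Section inclusion.
Variables (YY : metric_family R) (BB : subfamily YY).

Inductive inclusion_mem : forall X Y : metricType R, (X -> Y) -> Prop :=
  InclusionMem (Y : metricType R) (B : set Y) of BB Y B :
  inclusion_mem (set_val : set_type B -> Y).

Lemma inclusion_mem_sub (X Y : metricType R) (f : X -> Y) :
  inclusion_mem f -> members BB X /\ YY Y.
Proof.
by case=> {X Y f} Y B BBB; split; [exists Y, B|exact: sf_sub BBB].
Qed.

Lemma inclusion_mem_total (X : metricType R) :
  members BB X -> exists (Y : metricType R) (f : X -> Y), inclusion_mem f.
Proof. by move=> [Y [B [BBB ->]]]; exists Y, set_val. Qed.

Definition inclusion : family_map (members BB) YY :=
  FamilyMap inclusion_mem_sub inclusion_mem_total.

Lemma inclusion_coarse_embedding : coarse_embedding inclusion.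
Proof.
split; first by exists id; split=> // _ _ _ [Y B BBB] x y.
apply: (@effectively_proper_of_upper_bound _ _ _ id) => //.
by move=> _ _ _ [Y B BBB] x y.
Qed.

End inclusion.

(** * Coarse equivalences *)

(** If [g] is a coarse inverse of [f] up to [C], moving [x] and [y] to
    [g (f x)] and [g (f y)] costs [C] each, and the distance between the latter
    is controlled by [mdist (f x) (f y)]. *)
Lemma coarse_equivalence_embedding XX YY (F : family_map XX YY) :
  coarse_equivalence F -> coarse_embedding F.
Proof.
move=> [Fc [G [[rho [[rho_ge0 rho_nd] Grho]] [C [C0 GFC _]] _]]].
split=> //.
apply: (@effectively_proper_of_upper_bound _ _ _ (fun s => C + C + rho s)).
  split=> [t t0|s t s0 st]; first by rewrite !addr_ge0 ?rho_ge0.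
  by rewrite lerD2l rho_nd.
move=> X Y f Ff x y; have [_ YYY] := fm_sub Ff.
have [X' [g Gg]] := fm_total G YYY.
have [|h idh] := GFC X X' (g \o f); first by exists Y, f, g.
case: {X X' h} idh f g Ff Gg x y => X _ f g Ff Gg x y gfC.
have := Grho _ _ _ Gg (f x) (f y).
have := metric_triangle x (g (f x)) y.
have := metric_triangle (g (f x)) (g (f y)) y.
have := gfC x; have := gfC y; rewrite /= (metric_sym x (g (f x))).
lra.
Qed.

Lemma coarsely_equivalent_sym XX YY :
  coarsely_equivalent XX YY -> coarsely_equivalent YY XX.
Proof. by move=> [F [Fc [G [Gc GF FG]]]]; exists G; split=> //; exists F. Qed.

(** * Coarse permanence *)

Lemma well_order_lt_wf d (W : orderType d) :
  well_order (fun b c : W => (b <= c)%O) ->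
  well_founded (fun b c : W => (b < c)%O).
Proof.
move=> W_wo a; apply: contrapT => Na.
have [|m [[/asboolP Nm m_min] _]] := W_wo
    [pred b | `[< ~ Acc (fun b c : W => (b < c)%O) b >]].
  by exists a; apply/asboolP.
apply: Nm; constructor=> b bm; apply: contrapT => Nb.
have : (m <= b)%O by apply: m_min; apply/asboolP.
by rewrite leNgt bm.
Qed.

Lemma frakR_coarse_permanence d (W : orderType d)
    (W_wo : well_order (fun b c : W => (b <= c)%O)) (a : W) :
  coarse_permanence (R := R) (frakR a).
Proof.
elim/(well_founded_ind (well_order_lt_wf W_wo)): a => a IH XX YY F Ya.
case: {a YY} Ya IH F => [a YY a0 bY|a YY ZZ G a_gt0 ZZfin Gc GBB] IH F Fe.
  apply: frakR_zero => //.
  exact: bounded_family_effectively_proper Fe.2 bY.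
apply: (frakR_pos (F := family_comp G F)) => //.
  exact: coarse_comp Gc Fe.1.
move=> BB /GBB[b ba GBBb]; exists b => //.
rewrite members_inverse_image_comp.
exact: IH ba _ _ _ GBBb (restriction_coarse_embedding (inverse_image G BB) Fe).
Qed.

End coarse_permanence.

Theorem theorem2p10 (R : realType) (d : Order.disp_t) (W : orderType d)
    (W_wo : well_order (fun b c : W => (b <= c)%O)) (a : W) :
  [/\ coarse_permanence (R := R) (frakR a),
      forall (YY : metric_family R) (BB : subfamily YY),
        frakR a YY -> frakR a (members BB) &
      forall XX YY : metric_family R, coarsely_equivalent XX YY ->
        (frakR a XX <-> frakR a YY)].
Proof.
have perm := frakR_coarse_permanence (R := R) W_wo (a := a).
have half (XX YY : metric_family R) : coarsely_equivalent XX YY -> frakR a YY -> frakR a XX.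
  by move=> [F /coarse_equivalence_embedding Fe] Ya; exact: perm Ya Fe.
split=> [//|YY BB Ya|XX YY eqv].
  exact: perm Ya (inclusion_coarse_embedding BB).
by split; apply: half => //; exact: coarsely_equivalent_sym.
Qed.
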